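(* Let $(\Omega,\preceq)$ be a totally preordered space with smallest element $0_\Omega$ and largest element $1_\Omega$, and assume that $\Omega/\simeq$ is order complete. Let $(\underline F,\overline F)$ be a p-box on $(\Omega,\preceq)$ with $0$–$1$-valued $\underline F$, and let $B=\{x\in\Omega^*:\underline F(x)=0\}$ and $B^c=\Omega^*\setminus B$. Then $(\underline F,\overline F)$ is a possibility measure if and only if (i) $\overline F(x)=\overline F(x-)$ for all $x\in\Omega$ that have no immediate predecessor, and (ii) $B^c$ has a minimum, and in such a case, for all $A\subseteq\Omega$, $$\overline E_{\underline F,\overline F}(A)=\sup_{x\in A\cap[0_\Omega,\min B^c]}\overline F(x).$$
   Context: A total preorder $\preceq$ is reflexive, transitive, with any two elements comparable; $x\prec y$ means $x\preceq y$ and not $y\preceq x$; $x\simeq y$ means $x\preceq y$ and $y\preceq x$; $\Omega/\simeq$ is the quotient with its induced total order, and it is order complete if every subset has a supremum and an infimum. A formal element $0_\Omega-$ is added: $\Omega^*=\Omega\cup\{0_\Omega-\}$ with $0_\Omega-\prec x$ for all $x\in\Omega$. Minima of sets are with respect to the preorder (hence unique up to $\simeq$). $[0_\Omega,y]=\{z\in\Omega:z\preceq y\}$. A cumulative distribution function is a non-decreasing map $F:\Omega\to[0,1]$ with $F(1_\Omega)=1$, extended to $\Omega^*$ by $F(0_\Omega-)=0$. A p-box is a pair $(\underline F,\overline F)$ of cumulative distribution functions with $\underline F\le\overline F$. $F$ is $0$–$1$-valued if it takes only the values $0$ and $1$. For $x\in\Omega$, $F(x-)=\sup_{z\in\Omega^*,\,z\prec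 x}F(z)$. An immediate predecessor of $x\in\Omega$ is a $y\in\Omega^*$ with $y\prec x$ and no $z\in\Omega^*$ with $y\prec z\prec x$ (so $0_\Omega-$ is an immediate predecessor of $0_\Omega$). Suprema of numbers in $[0,1]$ over the empty set equal $0$. The natural extension of the p-box is $\overline E_{\underline F,\overline F}(A)=\sup P(A)$ for $A\subseteq\Omega$, the supremum being over all finitely additive probabilities $P$ on the power set of $\Omega$ with $\underline F(x)\le P([0_\Omega,x])\le\overline F(x)$ for all $x\in\Omega$. The p-box ''is a possibility measure'' if $\overline E_{\underline F,\overline F}(A)=\sup_{x\in A}\overline E_{\underline F,\overline F}(\{x\})$ for all $A\subseteq\Omega$. *)

(* Defs.v *)
From HB Require Import structures.
From mathcomp Require Import all_boot all_order all_algebra.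
From mathcomp Require Import all_classical all_reals.

Set Implicit Arguments.
Unset Strict Implicit.
Unset Printing Implicit Defensive.

Import Order.TTheory GRing.Theory Num.Theory.

Local Open Scope classical_set_scope.
Local Open Scope ring_scope.

(** The quotient of a preordered type by its indifference relation *)

Section quotient.
Context {d : Order.disp_t} {T : preorderType d}.

Definition sim : rel T := fun x y => (x <= y)%O && (y <= x)%O.

Lemma sim_refl : reflexive sim. Proof. by move=> x; rewrite /sim lexx. Qed.

Lemma sim_sym : symmetric sim. Proof. by move=> x y; rewrite /sim andbC. Qed.

Lemma sim_trans : transitive sim.
Proof.
move=> y x z /andP[xy yx] /andP[yz zy]; rewrite /sim.
by rewrite (le_trans xy yz) (le_trans zy yx).
Qed.

Canonical sim_equiv := EquivRel sim sim_refl sim_sym sim_trans.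

Definition simquot : Type := {eq_quot sim_equiv}%qT.
HB.instance Definition _ := Choice.copy simquot {eq_quot sim_equiv}%qT.
HB.instance Definition _ := EqQuotient.copy simquot {eq_quot sim_equiv}%qT.

Definition le_simquot : rel simquot := fun u v => (repr u <= repr v)%O.

Lemma le_simquot_refl : reflexive le_simquot.
Proof. by move=> u; exact: lexx. Qed.

Lemma le_simquot_anti : antisymmetric le_simquot.
Proof.
move=> u v uv; rewrite -[u]reprK -[v]reprK.
by apply/eqP; rewrite (@pi_eq_quot T sim_equiv).
Qed.

Lemma le_simquot_trans : transitive le_simquot.
Proof. by move=> v u w; rewrite /le_simquot; exact: le_trans. Qed.

HB.instance Definition _ := Order.Le_isPOrder.Build d simquot
  le_simquot_refl le_simquot_anti le_simquot_trans.

(** The order of the quotient does not depend on the representatives. *)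
Lemma le_pi_simquot (x y : T) :
  (\pi_simquot%qT x <= \pi_simquot%qT y)%O = (x <= y)%O.
Proof.
have sim_repr (z : T) : sim (repr (\pi_simquot%qT z)) z.
  by rewrite -[sim _ _](@pi_eq_quot T sim_equiv simquot) reprK.
have /andP[rx xr] := sim_repr x; have /andP[ry yr] := sim_repr y.
change (le_simquot (\pi_simquot%qT x) (\pi_simquot%qT y) = (x <= y)%O).
rewrite /le_simquot; apply/idP/idP => [rxry|xy].
  exact: le_trans xr (le_trans rxry ry).
exact: le_trans rx (le_trans xy yr).
Qed.

End quotient.
Arguments simquot {d} T.

Definition order_complete {d : Order.disp_t} (Q : porderType d) : Prop :=
  forall S : set Q, supremums S !=set0 /\ infimums S !=set0.

(** [star T] is [T] with one more element, [None], strictly below all others *)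

Definition star (T : Type) : Type := option T.
Definition emb {T : Type} (x : T) : star T := Some x.

HB.instance Definition _ (T : choiceType) := Choice.copy (star T) (option T).

Section star_order.
Context {d : Order.disp_t} {T : preorderType d}.

Definition le_star : rel (star T) := fun u v =>
  match u, v with
  | None, _ => true
  | Some _, None => false
  | Some x, Some y => (x <= y)%O
  end.

Lemma le_star_refl : reflexive le_star.
Proof. by case=> [x|] //=; exact: lexx. Qed.

Lemma le_star_trans : transitive le_star.
Proof. by case=> [y|] [x|] [z|] //=; exact: le_trans. Qed.

HB.instance Definition _ := Order.Le_isPreorder.Build d (star T)
  le_star_refl le_star_trans.

Lemma le_emb (x y : T) : (emb x <= emb y)%O = (x <= y)%O. Proof. by []. Qed.

Lemma lt_emb (x y : T) : (emb x < emb y)%O = (x < y)%O.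
Proof. by rewrite !lt_leAnge !le_emb. Qed.

Lemma lt_None_emb (x : T) : ((None : star T) < emb x)%O.
Proof. by rewrite lt_leAnge. Qed.

Definition immediate_predecessor (y : star T) (x : T) : Prop :=
  (y < emb x)%O /\ ~ exists z : star T, (y < z)%O /\ (z < emb x)%O.

Definition lower_segment (y : star T) : set T := [set z | (emb z <= y)%O].

End star_order.

Definition is_minimum {d : Order.disp_t} {U : preorderType d}
  (S : set U) (m : U) : Prop := S m /\ forall y, S y -> (m <= y)%O.

(** In the sequel [sup] is the supremum of a set of reals, equal to [0] on the
    empty set. *)

Section pbox.
Context {R : realType} {d : Order.disp_t} {T : tbPreorderType d}.
Implicit Types (F lo hi : T -> R) (P : set T -> R).

Definition is_cdf F : Prop :=
  [/\ forall x, 0 <= F x <= 1,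
      {homo F : x y / (x <= y)%O >-> x <= y}
    & F (\top)%O = 1].

Definition is_pbox lo hi : Prop :=
  [/\ is_cdf lo, is_cdf hi & forall x, lo x <= hi x].

Definition zero_one_valued F : Prop := forall x, F x = 0 \/ F x = 1.

Definition extend F (z : star T) : R := if z is Some x then F x else 0.

Definition left_value F (x : T) : R :=
  sup [set extend F z | z in [set z : star T | (z < emb x)%O]].

Definition finitely_additive_probability P : Prop :=
  [/\ forall A, 0 <= P A,
      P setT = 1
    & forall A B, A `&` B = set0 -> P (A `|` B) = P A + P B].

Definition compatible lo hi : set (set T -> R) :=
  [set P | finitely_additive_probability P /\
           forall x, lo x <= P (lower_segment (emb x)) <= hi x].

Definition natural_extension lo hi (A : set T) : R :=
  sup [set P A | P in compatible lo hi].

Definition is_possibility_measure lo hi : Prop :=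
  forall A : set T, natural_extension lo hi A =
    sup [set natural_extension lo hi [set x] | x in A].

End pbox.

(* Main.v *)
Require Import Defs.
From mathcomp Require Import all_boot all_order all_algebra.
From mathcomp Require Import all_classical all_reals.
From mathcomp Require Import lra.

Import Order.TTheory GRing.Theory Num.Theory.

Local Open Scope classical_set_scope.
Local Open Scope ring_scope.

(** The natural extension is computed from two-point mixtures
    [t U + (1 - t) V] of 0-1-valued probabilities, i.e. of ultrafilters.
    Let [m = min B^c].  Mixing an ultrafilter concentrated at [x <= m], or just
    below such an [x] without immediate predecessor, with weight [hi x], and the
    Dirac mass at [m], one gets compatible probabilities that give mass [hi x]
    to [{x}], respectively to [{z | z < x}]; conversely [P A <= hi a] where
    [a] is the supremum of [A] below [m], and condition (i) is what is needed
    when [a] is not attained.  If [B^c] has no minimum, an ultrafilter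
    converging to its infimum from above gives mass 1 to [B^c], while every
    point of [B^c] is null. *)

(** * Suprema of bounded real images, with value 0 on the empty set *)

Lemma sup_image_le {R : realType} {I : Type} (A : set I) (f : I -> R) (c : R) :
  0 <= c -> (forall i, A i -> f i <= c) -> sup [set f i | i in A] <= c.
Proof.
move=> c0 fc; have [->|/set0P[i Ai]] := eqVneq A set0.
  by rewrite image_set0 sup0.
by apply: ge_sup; [exists (f i); exists i | move=> _ [j Aj <-]; exact: fc].
Qed.

Lemma le_sup_image {R : realType} {I : Type} (A : set I) (f : I -> R) (M : R)
    (i : I) :
  (forall j, A j -> f j <= M) -> A i -> f i <= sup [set f j | j in A].
Proof.
move=> fM Ai; apply: ub_le_sup; last by exists i.
by exists M => _ [j Aj <-]; exact: fM.
Qed.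

Lemma sup_image_ge0 {R : realType} {I : Type} (A : set I) (f : I -> R) (M : R) :
  (forall i, A i -> 0 <= f i <= M) -> 0 <= sup [set f i | i in A].
Proof.
move=> fM; have [->|/set0P[i Ai]] := eqVneq A set0.
  by rewrite image_set0 sup0.
have /andP[fi0 _] := fM i Ai; apply: le_trans fi0 _.
by apply: (le_sup_image _ _ M) => // j /fM/andP[].
Qed.

(** * Finitely additive probabilities, and those given by ultrafilters *)

Section probability.
Context {R : realType} {d : Order.disp_t} {T : tbPreorderType d}.
Implicit Types (P Q : set T -> R) (A B : set T) (U : set_system T).

Lemma fap_mono P A B :
  finitely_additive_probability P -> A `<=` B -> P A <= P B.
Proof.
move=> [P0 _ PD] AB; have -> : B = A `|` (B `\` A) by rewrite setDUK.
by rewrite PD ?setDIK// lerDl.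
Qed.

Lemma fap_le1 P A : finitely_additive_probability P -> P A <= 1.
Proof. by move=> Pf; case: (Pf) => _ <- _; exact: fap_mono. Qed.

Lemma fap_null P A B :
  finitely_additive_probability P -> P A = 1 -> A `&` B = set0 -> P B = 0.
Proof.
move=> Pf PA AB; have [P0 _ PD] := Pf.
have := fap_le1 P (A `|` B) Pf; rewrite PD// PA gerDl => PB.
by apply/eqP; rewrite eq_le PB P0.
Qed.

Lemma fap_setI P A B :
  finitely_additive_probability P -> P B = 1 -> P A = P (A `&` B).
Proof.
move=> Pf PB; have [_ _ PD] := Pf.
rewrite -[in LHS](setUIDK A B) PD; first last.
  by rewrite setDE setIACA setICr setI0.
rewrite (fap_null P B (A `\` B))//; first by rewrite addr0.
by rewrite setDIK.
Qed.

Lemma fap_mix (t : R) P Q : 0 <= t <= 1 ->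
  finitely_additive_probability P -> finitely_additive_probability Q ->
  finitely_additive_probability (fun A => t * P A + (1 - t) * Q A).
Proof.
move=> /andP[t0 t1] [P0 P1 PD] [Q0 Q1 QD]; split=> [A||A B AB].
- by rewrite addr_ge0// mulr_ge0// subr_ge0.
- by rewrite P1 Q1; lra.
- by rewrite PD// QD//; lra.
Qed.

Definition ultra_prob U A : R := (`[< U A >])%:R.

Lemma ultra_probT U A : U A -> ultra_prob U A = 1.
Proof. by move=> UA; rewrite /ultra_prob asboolT. Qed.

Lemma ultra_probF U A : ~ U A -> ultra_prob U A = 0.
Proof. by move=> UA; rewrite /ultra_prob asboolF. Qed.

(** For disjoint [A] and [B]: if [A] is in [U] then [B] is not, since their intersection is empty;
    if the complement of [A] is in [U], then the union is in [U] exactly when [B] is. *)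
Lemma ultra_prob_fap U :
  UltraFilter U -> finitely_additive_probability (ultra_prob U).
Proof.
move=> UU; split=> [A||A B AB]; first by rewrite ler0n.
- by rewrite ultra_probT//; exact: filterT.
- have [UA|UcA] := in_ultra_setVsetC A UU.
    have UB : ~ U B.
      by move=> /(filterI UA); rewrite AB; exact: filter_not_empty.
    rewrite (ultra_probT U A)// (ultra_probF U B)// addr0 ultra_probT//.
    by apply: filterS UA => x; left.
  have UA : ~ U A.
    by move=> /(filterI UcA); rewrite setICl; exact: filter_not_empty.
  rewrite (ultra_probF U A)// add0r /ultra_prob; congr (nat_of_bool _)%:R.
  apply/asbool_equiv_eq; split=> [UAB|]; last by apply: filterS => x; right.
  by apply: filterS (filterI UcA UAB) => x [nAx [|]].
Qed.

(** A chain of nonempty sets is a filter base, and its filter extends to an ultrafilter. This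
    supplies ultrafilters that converge to a point from one side only. *)
Lemma ultra_from {I : Type} (D : set I) (S : I -> set T) :
  D !=set0 ->
  (forall i, D i -> S i !=set0) ->
  (forall i j, D i -> D j -> S i `<=` S j \/ S j `<=` S i) ->
  exists U, UltraFilter U /\ forall i, D i -> U (S i).
Proof.
move=> D0 Sne Sdir.
have Ffrom : Filter (filter_from D S).
  apply: filter_from_filter => // i j Di Dj.
  have [ij|ji] := Sdir _ _ Di Dj; [exists i|exists j] => //.
    by rewrite subsetI; split.
  by rewrite subsetI; split.
have Pfrom : ProperFilter (filter_from D S) by exact: filter_from_proper.
have [U [UU DU]] := ultraFilterLemma Pfrom.
by exists U; split=> // i Di; apply: DU; exists i.
Qed.

End probability.

(** * The natural extension of a p-box with 0-1-valued [lo] *)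

Section natural_extension.
Context {R : realType} {d : Order.disp_t} {T : tbPreorderType d}.
Variables (lo hi : T -> R).
Implicit Types (x y z : T) (A : set T).

Lemma natural_extension_le A (c : R) : 0 <= c ->
  (forall P, compatible lo hi P -> P A <= c) -> natural_extension lo hi A <= c.
Proof. by move=> c0 Pc; apply: sup_image_le. Qed.

Lemma le_natural_extension P A :
  compatible lo hi P -> P A <= natural_extension lo hi A.
Proof.
move=> Pc; apply: (le_sup_image _ (fun P : set T -> R => P A) 1) => // Q [Qf _].
exact: fap_le1.
Qed.

Lemma natural_extension_ge0 A : 0 <= natural_extension lo hi A.
Proof.
apply: (sup_image_ge0 _ (fun P : set T -> R => P A) 1) => P [Pf _].
by rewrite (fap_le1 P)// andbT; case: Pf.
Qed.

Hypothesis T_total : total (<=%O : rel T).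
Hypothesis T_complete : order_complete (simquot T).
Hypothesis lo_hi_pbox : is_pbox lo hi.
Hypothesis lo01 : zero_one_valued lo.

Let lo_mono x y : (x <= y)%O -> lo x <= lo y.
Proof. by case: lo_hi_pbox => -[_ + _] _ _; apply. Qed.

Let hi_mono x y : (x <= y)%O -> hi x <= hi y.
Proof. by case: lo_hi_pbox => _ [_ + _] _; apply. Qed.

Let hi_ge0 x : 0 <= hi x.
Proof. by case: lo_hi_pbox => _ [+ _ _] _ => /(_ x)/andP[]. Qed.

Let hi_le1 x : hi x <= 1.
Proof. by case: lo_hi_pbox => _ [+ _ _] _ => /(_ x)/andP[]. Qed.

Let hi1 x : lo x = 1 -> hi x = 1.
Proof.
move=> lox; apply/eqP; rewrite eq_le hi_le1 -lox.
by case: lo_hi_pbox => _ _; apply.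
Qed.

Let lo_up x y : lo x = 1 -> (x <= y)%O -> lo y = 1.
Proof.
move=> lox /lo_mono; rewrite lox; have [->|//] := lo01 y.
by rewrite ler10.
Qed.

Let ltNle x y : ~ (x <= y)%O -> (y < x)%O.
Proof.
move=> /negP xy; have := T_total x y.
by rewrite lt_leAnge xy andbT (negbTE xy).
Qed.

Lemma lower_segmentS x y : (x <= y)%O ->
  lower_segment (emb x) `<=` lower_segment (emb y).
Proof. by move=> xy z; rewrite /lower_segment/= !le_emb => /le_trans; apply. Qed.

Lemma left_value_ge z x : (z < x)%O -> hi z <= left_value hi x.
Proof.
move=> zx.
apply: (le_sup_image [set u : star T | (u < emb x)%O] (extend hi) 1 (emb z)).
  by move=> [y|] _ //=.
by rewrite /= lt_emb.
Qed.

Lemma left_value_ge0 x : 0 <= left_value hi x.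
Proof.
apply: (sup_image_ge0 _ _ 1) => -[z|] _ /=; first by rewrite hi_ge0 hi_le1.
by rewrite lexx ler01.
Qed.

Lemma left_value_le x (c : R) : 0 <= c ->
  (forall z, (z < x)%O -> hi z <= c) -> left_value hi x <= c.
Proof.
move=> c0 hc; apply: sup_image_le => // -[z|] //= zx.
by apply: hc; rewrite -lt_emb.
Qed.

(** Where [lo] is 0, [V] gives the segment no mass, and [U] adds [t] only if [hi] is at least [t].
    Where [lo] is 1, both give full mass and [hi] is 1 too. *)
Lemma ultra_mix_compatible (U V : set_system T) (t : R) :
  UltraFilter U -> UltraFilter V -> 0 <= t <= 1 ->
  (forall z, V (lower_segment (emb z)) <-> lo z = 1) ->
  (forall z, lo z = 1 -> U (lower_segment (emb z))) ->
  (forall z, U (lower_segment (emb z)) -> t <= hi z) ->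
  compatible lo hi
    (fun A => t * ultra_prob U A + (1 - t) * ultra_prob V A).
Proof.
move=> UU UV t01 Vlo Ulo Uhi; split.
  by apply: fap_mix => //; exact: ultra_prob_fap.
move=> z; have [loz|loz] := lo01 z.
  rewrite loz (ultra_probF V); last first.
    by move=> /Vlo; rewrite loz => /esym/eqP; rewrite oner_eq0.
  rewrite mulr0 addr0; have /andP[t0 _] := t01.
  have [Uz|Uz] := pselect (U (lower_segment (emb z))).
    by rewrite ultra_probT// mulr1 t0 Uhi.
  by rewrite ultra_probF// mulr0 lexx hi_ge0.
rewrite loz hi1// !ultra_probT; [|exact/Vlo|exact: Ulo].
by rewrite !mulr1 addrC subrK lexx.
Qed.

Lemma possibility_minimum : is_possibility_measure lo hi ->
  exists m, lo m = 1 /\ forall y, lo y = 1 -> (m <= y)%O.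
Proof.
move=> poss; apply: contrapT => nomin.
have below x : lo x = 1 -> exists y, lo y = 1 /\ (y < x)%O.
  move=> lox; apply: contrapT => nox; apply: nomin; exists x; split=> // y loy.
  by apply: contrapT => /ltNle yx; apply: nox; exists y.
pose Bc := [set x | lo x = 1].
have lotop : lo \top%O = 1 by case: lo_hi_pbox => -[].
(* [U] lives on [Bc] and converges to its infimum from above, so the segments it contains are
   exactly those of the points of [Bc]. *)
have [U [UU BcU]] : exists U, UltraFilter U /\
    forall x, Bc x -> U (Bc `&` lower_segment (emb x)).
  apply: ultra_from; first by exists \top%O.
    by move=> x Bcx; exists x; split=> //; exact: lexx.
  move=> x y _ _; have /orP[xy|yx] := T_total x y; [left|right];
    by apply: setIS; exact: lower_segmentS.
have Ulo z : U (lower_segment (emb z)) <-> lo z = 1.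
  split=> [Uz|loz]; last by apply: filterS (BcU z loz) => y [].
  have [y [[loy _] yz]] := filter_ex (filterI (BcU _ lotop) Uz).
  exact: lo_up loy yz.
(* With weight 1 the mixture is [ultra_prob U] itself. *)
have Pc : compatible lo hi
    (fun A => 1 * ultra_prob U A + (1 - 1) * ultra_prob U A).
  apply: ultra_mix_compatible => //; first by rewrite ler01 lexx.
    by move=> z /Ulo.
  by move=> z /Ulo/hi1 ->.
have := le_natural_extension _ Bc Pc; apply/negP; rewrite -ltNge.
rewrite subrr mul0r addr0 mul1r ultra_probT; last first.
  by apply: filterS (BcU _ lotop) => y [].
rewrite poss; apply: le_lt_trans ltr01; apply: sup_image_le => // x lox.
(* Some [y] in [Bc] is strictly below [x], so every compatible [P] gives full mass to a segment that
   misses [x]. *)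
apply: natural_extension_le => // P [Pf PF]; have [y [loy yx]] := below x lox.
rewrite (fap_null P (lower_segment (emb y)))//.
  have := PF y; rewrite loy => /andP[Py _].
  by apply/eqP; rewrite eq_le Py (fap_le1 P).
rewrite -subset0 => z [zy zx]; move: zy; rewrite zx /lower_segment/= le_emb.
by rewrite lt_geF.
Qed.

(** * The case where the complement of B has a minimum [m] *)

Section minimum.
Variable m : T.
Hypothesis lo_m : lo m = 1.
Hypothesis m_min : forall y, lo y = 1 -> (m <= y)%O.

(** The Dirac mass at [m] has cumulative distribution function [lo], so mixing it with [U], taken
    with weight [hi x], is compatible; the [U] part alone gives [A] mass [hi x]. *)
Lemma hi_le_natural_extension_ultra (U : set_system T) x A :
  UltraFilter U -> U (lower_segment (emb m)) ->
  (forall z, U (lower_segment (emb z)) -> hi x <= hi z) ->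
  U A -> hi x <= natural_extension lo hi A.
Proof.
move=> UU Um Uhi UA.
have UV := principal_filter_ultra m.
have Pc : compatible lo hi (fun A => hi x * ultra_prob U A +
    (1 - hi x) * ultra_prob (principal_filter m) A).
  apply: ultra_mix_compatible => //; first by rewrite hi_ge0 hi_le1.
    move=> z; rewrite principal_filterP; split=> [mz|/m_min//].
    exact: lo_up lo_m mz.
  by move=> z /m_min mz; apply: filterS Um; exact: lower_segmentS.
apply: le_trans (le_natural_extension _ A Pc).
by rewrite (ultra_probT U)// mulr1 lerDl mulr_ge0 ?ler0n// subr_ge0.
Qed.

Lemma hi_le_natural_extension x A :
  A x -> (x <= m)%O -> hi x <= natural_extension lo hi A.
Proof.
move=> Ax xm; apply: (hi_le_natural_extension_ultra (principal_filter x)).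
- exact: principal_filter_ultra.
- exact/principal_filterP.
- by move=> z /principal_filterP; exact: hi_mono.
- exact/principal_filterP.
Qed.

Lemma compatible_minimum P : compatible lo hi P ->
  P (lower_segment (emb m)) = 1.
Proof.
move=> [Pf PF]; have := PF m; rewrite lo_m => /andP[Pm _].
by apply/eqP; rewrite eq_le Pm (fap_le1 P).
Qed.

(** If [x <= m], the segment of [x] bounds the mass of the point by [hi x], and the mixture built on
    the Dirac mass at [x] reaches it. Otherwise the point misses the segment of [m], which has mass
    1. *)
Lemma natural_extension_set1 x :
  natural_extension lo hi [set x] = if (x <= m)%O then hi x else 0.
Proof.
apply/eqP; rewrite eq_le; case: ifPn => xm; apply/andP; split.
- apply: natural_extension_le => // P [Pf PF].
  have /andP[_] := PF x; apply: le_trans; apply: fap_mono => // _ ->.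
  exact: lexx.
- exact: hi_le_natural_extension.
- apply: natural_extension_le => // P Pc.
  rewrite (fap_null P (lower_segment (emb m)))//; first by case: Pc.
    exact: compatible_minimum.
  by rewrite -subset0 => z [zm zx]; move: zm xm; rewrite zx => /[swap] /negP.
- exact: natural_extension_ge0.
Qed.

(** Points above [m] contribute 0, so dropping them keeps the supremum, even if nothing remains,
    since the empty supremum is 0. *)
Lemma sup_natural_extension_set1 A :
  sup [set natural_extension lo hi [set x] | x in A] =
  sup [set hi x | x in A `&` lower_segment (emb m)].
Proof.
apply/eqP; rewrite eq_le; apply/andP; split; apply: sup_image_le.
- by apply: (sup_image_ge0 _ _ 1) => x _; rewrite hi_ge0 hi_le1.
- move=> x Ax; rewrite natural_extension_set1; case: ifPn => xm.
    exact: (le_sup_image _ hi 1).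
  by apply: (sup_image_ge0 _ _ 1) => y _; rewrite hi_ge0 hi_le1.
- apply: (sup_image_ge0 _ _ 1) => x _; rewrite natural_extension_set1.
  by case: ifP => _; rewrite ?lexx ?ler01// hi_ge0 hi_le1.
- move=> x [Ax xm].
  have <- : natural_extension lo hi [set x] = hi x.
    by rewrite natural_extension_set1 ifT.
  apply: (le_sup_image _ (fun x => natural_extension lo hi [set x]) 1) => //.
  by move=> y _; rewrite natural_extension_set1; case: ifP.
Qed.

(** Without an immediate predecessor, all open intervals from some [y < x] up to [x] are nonempty;
    they form a chain, hence lie in a common ultrafilter that converges to [x] from below. *)
Lemma natural_extension_left x :
  (~ exists y : star T, immediate_predecessor y x) -> (x <= m)%O ->
  hi x <= natural_extension lo hi [set z | (z < x)%O].
Proof.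
move=> nopred xm.
pose S (y : star T) := [set z | (y < emb z)%O /\ (z < x)%O].
have S_neq0 (y : star T) : (y < emb x)%O -> S y !=set0.
  move=> yx; apply: contrapT => noz; apply: nopred; exists y; split=> //.
  move=> [[z|] [yz zx]]; last by case: (y) yz.
  by apply: noz; exists z; split=> //; rewrite -lt_emb.
have [U [UU SU]] : exists U, UltraFilter U /\
    forall y : star T, (y < emb x)%O -> U (S y).
  (* The index [None] makes the family nonempty; its interval is all of the points strictly below
     [x]. *)
  apply: ultra_from => //; first by exists None; exact: lt_None_emb.
  move=> u v _ _.
  have /orP[uv|vu] : (u <= v)%O || (v <= u)%O.
  - by case: u v => [u|] [v|]//; exact: T_total.
  - by right => z [vz zx]; split=> //; exact: le_lt_trans uv vz.
  - by left => z [uz zx]; split=> //; exact: le_lt_trans vu uz.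
have Ux : U [set z | (z < x)%O].
  by apply: filterS (SU None (lt_None_emb x)) => z [].
apply: (hi_le_natural_extension_ultra U) => //.
  by apply: filterS Ux => z /ltW zx; exact: le_trans zx xm.
(* If [z < x], the interval from [z] to [x] would be in [U] and yet miss the segment of [z]. *)
move=> z Uz; apply: hi_mono; apply: contrapT => /ltNle zx.
have [] := filter_ex (filterI Uz (SU (emb z) _)); first by rewrite lt_emb.
by move=> y [yz []]; rewrite (le_gtF yz).
Qed.

(** For [x <= m], the possibility property is applied to the set of points strictly below [x]: its
    natural extension is at least [hi x], while each of its points contributes at most the left
    value. *)
Lemma possibility_left_value x : is_possibility_measure lo hi ->
  (~ exists y : star T, immediate_predecessor y x) -> hi x = left_value hi x.
Proof.
move=> poss nopred; apply/eqP; rewrite eq_le; apply/andP; split; last first.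
  by apply: left_value_le => // z /ltW; exact: hi_mono.
have [xm|/ltNle mx] := pselect (x <= m)%O.
  apply: le_trans (natural_extension_left x nopred xm) _.
  rewrite poss sup_natural_extension_set1.
  apply: sup_image_le => [|z [zx _]]; first exact: left_value_ge0.
  exact: left_value_ge.
(* Above [m] the left value is already at least [hi m = 1]. *)
by apply: le_trans (hi_le1 x) _; rewrite -(hi1 m lo_m); exact: left_value_ge.
Qed.

Lemma natural_extension_le_sup A :
  (forall x : T, (~ exists y : star T, immediate_predecessor y x) ->
     hi x = left_value hi x) ->
  natural_extension lo hi A <=
  sup [set hi x | x in A `&` lower_segment (emb m)].
Proof.
move=> hi_left; set A' := A `&` _.
have sup_ge x : A' x -> hi x <= sup [set hi x | x in A'].
  by move=> A'x; exact: (le_sup_image _ hi 1).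
apply: natural_extension_le => [|P Pc].
  by apply: (sup_image_ge0 _ _ 1) => x _; rewrite hi_ge0 hi_le1.
have [Pf PF] := Pc; rewrite (fap_setI P A _ Pf (compatible_minimum P Pc)).
rewrite -/A'; have [->|/set0P[x0 A'x0]] := eqVneq A' set0.
  rewrite image_set0 sup0 (fap_null P setT)//; last by rewrite setI0.
  by case: Pf.
(* Completeness is that of the quotient; a representative [a] of the supremum there is a least upper
   bound of [A'] up to indifference. *)
have [[u [u_ub u_lub]] _] := T_complete [set (\pi_(simquot T) x)%qT | x in A'].
pose a : T := repr u.
have a_ub x : A' x -> (x <= a)%O.
  by move=> A'x; rewrite -le_pi_simquot reprK; apply: u_ub; exists x.
have a_lub b : (forall x, A' x -> (x <= b)%O) -> (a <= b)%O.
  move=> b_ub; rewrite -le_pi_simquot reprK; apply: u_lub => _ [x A'x <-].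
  by rewrite le_pi_simquot; exact: b_ub.
have PA' : P A' <= hi a.
  by have /andP[_] := PF a; apply: le_trans; exact: fap_mono.
apply: le_trans PA' _.
(* If [A'] has a point indifferent to [a], monotonicity of [hi] concludes; otherwise [A'] approaches
   [a] strictly from below. *)
have [[x [A'x ax]]|not_attained] := pselect (exists x, A' x /\ (a <= x)%O).
  exact: le_trans (hi_mono _ _ ax) (sup_ge x A'x).
have lt_a x : A' x -> (x < a)%O.
  by move=> A'x; apply: ltNle => ax; apply: not_attained; exists x.
have between z : (z < a)%O -> exists x, A' x /\ (z < x)%O.
  move=> za; apply: contrapT => nox; move: za; rewrite le_gtF//.
  by apply: a_lub => x A'x; apply: contrapT => /ltNle zx; apply: nox; exists x.
(* A supremum that is not attained has no immediate predecessor: a point of [A'] lies strictly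
   between any [y < a] and [a], and [x0] does so for [None]. *)
rewrite hi_left; last first.
  move=> [[y|] [ya noz]]; apply: noz.
    move: ya; rewrite -[Some y]/(emb y) lt_emb => /between[x [A'x yx]].
    by exists (emb x); rewrite !lt_emb; split=> //; exact: lt_a.
  by exists (emb x0); rewrite lt_emb; split; [exact: lt_None_emb|exact: lt_a].
apply: left_value_le => [|z za].
  exact: le_trans (hi_ge0 x0) (sup_ge x0 A'x0).
have [x [A'x zx]] := between z za.
exact: le_trans (hi_mono _ _ (ltW zx)) (sup_ge x A'x).
Qed.

End minimum.
End natural_extension.

(** * The equivalence and the formula, with minima taken in [star T] *)

Theorem proposition15 (R : realType) (d : Order.disp_t) (T : tbPreorderType d)
    (T_total : total (<=%O : rel T))
    (T_complete : order_complete (simquot T))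
    (lo hi : T -> R)
    (lo_hi_pbox : is_pbox lo hi)
    (lo01 : zero_one_valued lo) :
  let B : set (star T) := [set x | extend lo x = 0] in
  (is_possibility_measure lo hi <->
     (forall x : T, (~ exists y : star T, immediate_predecessor y x) ->
        hi x = left_value hi x)
     /\ (exists m : star T, is_minimum (~` B) m))
  /\
  (is_possibility_measure lo hi ->
     forall m : star T, is_minimum (~` B) m ->
     forall A : set T,
       natural_extension lo hi A
       = sup [set hi x | x in A `&` lower_segment m]).
Proof.
move=> B.
have lo_Bc x : (~` B) (emb x) <-> lo x = 1.
  rewrite /B /=; split=> [|->]; last by apply/eqP; rewrite oner_eq0.
  by have [->|] := lo01 x.
(* [None] has extended value 0 and so lies in [B]; a minimum of the complement is thus a point of
   [T]. *)
have minP m : is_minimum (~` B) m <-> exists2 m', m = emb m' &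
    lo m' = 1 /\ forall y, lo y = 1 -> (m' <= y)%O.
  split=> [[]|[m' -> [lom' m'_min]]].
    case: m => [m'|/(_ erefl)//] /lo_Bc lom' m'_min; exists m' => //; split=> //.
    by move=> y /lo_Bc /m'_min.
  split; first exact/lo_Bc.
  by case=> [y|/(_ erefl)//] /lo_Bc; exact: m'_min.
(* With singletons computed, the possibility property and the claimed formula say the same, which
   serves both the equivalence and the final claim. *)
have ext_sup m : is_minimum (~` B) m ->
    is_possibility_measure lo hi <-> forall A, natural_extension lo hi A =
      sup [set hi x | x in A `&` lower_segment m].
  move=> /minP[m' -> [lom' m'_min]].
  by split=> E A; rewrite E (sup_natural_extension_set1 lo hi _ _ m').
split; last by move=> poss m /ext_sup[+ _]; apply.
split=> [poss|[hi_left [m mmin]]].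
  have [m [lom m_min]] :=
    possibility_minimum lo hi T_total lo_hi_pbox lo01 poss.
  have mmin : is_minimum (~` B) (emb m) by apply/minP; exists m.
  split; last by exists (emb m).
  by move=> x; exact: possibility_left_value m_min _ poss.
move: (mmin) => /minP[m' mE [lom' m'_min]].
apply/(ext_sup m mmin) => A; apply/eqP; rewrite eq_le; apply/andP; split.
  by rewrite mE; exact: natural_extension_le_sup.
rewrite mE; apply: sup_image_le; first exact: natural_extension_ge0.
by move=> x [Ax xm]; apply: (hi_le_natural_extension lo hi _ _ m').
Qed.
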